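(* Let $T$ be an oriented tree that is grounded, and let $U(T)=\{v\in V(T):\deg^-_T(v)\geq 2\}$. Suppose that the minimal subtree of $T$ containing the vertex set $U(T)$ is an out-arborescence. Then there exists an integer $d=d(T)$ such that every finite digraph $G$ with $\delta^+(G)\geq d$ contains $T$ as a subgraph.
   Context: Digraphs are finite, have no loops and no multiple copies of the same edge, but may contain two edges in opposite directions between a pair of vertices. An oriented tree is an orientation of an undirected tree. For an oriented tree $T$, a height function $h_T\colon V(T)\to\mathbb{Z}$ is a function with $h_T(v)=h_T(u)+1$ for every edge $(u,v)\in E(T)$ (unique up to an additive constant). $T$ is grounded if $h_T$ is constant on the set of vertices of in-degree at least $2$. An out-arborescence is an oriented tree in which all edges are oriented away from a designated root vertex. $\delta^+(G)$ is the minimum out-degree of $G$; containing $T$ as a subgraph means having a subgraph isomorphic to $T$. *)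

(* Defs.v *)
From mathcomp Require Import all_boot all_algebra.
Set Implicit Arguments. Unset Strict Implicit. Unset Printing Implicit Defensive.
Import GRing.Theory Num.Theory.

(* A digraph on a finite vertex type V is an edge relation t : rel V. *)

Definition und_adj (V : finType) (t : rel V) : rel V := fun a b => t a b || t b a.

Definition oriented_tree (V : finType) (t : rel V) : Prop :=
  [/\ 0 < #|V|,
      irreflexive t,
      (forall u v, t u v -> ~~ t v u),
      (forall u v, connect (und_adj t) u v) &
      #|[set p : V * V | t p.1 p.2]| = #|V| - 1].

Definition indeg (V : finType) (t : rel V) (v : V) : nat := #|[set u | t u v]|.

Definition Uset (V : finType) (t : rel V) : {set V} := [set v | 2 <= indeg t v].

Definition height_fun (V : finType) (t : rel V) (h : V -> int) : Prop :=
  forall u v, t u v -> h v = (h u + 1)%R.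

Definition grounded (V : finType) (t : rel V) : Prop :=
  exists h : V -> int, height_fun t h /\
    (forall u v, u \in Uset t -> v \in Uset t -> h u = h v).

Definition connected_set (V : finType) (t : rel V) (X : {set V}) : bool :=
  [forall x in X, forall y in X,
     connect [rel a b | und_adj t a b && (a \in X) && (b \in X)] x y].

(* vertex set of the minimal subtree containing A: intersection of all
   vertex sets of subtrees (connected vertex sets) containing A *)
Definition min_subtree (V : finType) (t : rel V) (A : {set V}) : {set V} :=
  [set v | [forall X : {set V}, (A \subset X) && connected_set t X ==> (v \in X)]].

(* the subtree of the oriented tree t induced on S is an out-arborescence:
   there is a root r in S from which every vertex of S is reached by a directed
   path inside S (for a tree this means all edges are oriented away from r).
   The empty subtree (S = set0) is accepted. *)
Definition out_arborescence_on (V : finType) (t : rel V) (S : {set V}) : Prop :=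
  S = set0 \/
  exists2 r, r \in S &
    forall v, v \in S -> connect [rel a b | t a b && (a \in S) && (b \in S)] r v.

Definition contains_subgraph (V W : finType) (t : rel V) (g : rel W) : Prop :=
  exists f : V -> W, injective f /\ forall u v, t u v -> g (f u) (f v).

Definition min_outdeg_ge (W : finType) (g : rel W) (d : nat) : Prop :=
  forall x, d <= #|[set y | g x y]|.

(* Main.v *)
Require Import Defs.
From mathcomp Require Import all_boot all_algebra.
From mathcomp Require Import zify.

(** Call a vertex [v] of the host digraph well fed if, after deleting any few
    other vertices, [v] is still the end of a directed path of length [l].  If
    no vertex were well fed, every walk could be read backwards from its end in
    jumps of length at most [l], each landing in a bounded set depending only
    on its starting point; of the [d ^ i] continuations of a forward stretch of
    length [i] only [d ^ i.-1] hit the prescribed end, so too few walks would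
    exist.  Discarding successively the vertices with many out-neighbours of
    level [0], ..., [k.-1] (level [0] being well fed) then produces a vertex of
    level [k], from which an out-arborescence can be embedded greedily with all
    its vertices at depth [k] well fed.

    In the tree, enlarge the minimal subtree upwards until its root is a source
    or lies in [U(T)].  By groundedness all of [U(T)] lies at a single depth of
    this out-arborescence.  What remains is attached either by an out-edge,
    which is handled greedily, or by an in-edge at a vertex of [U(T)]; the
    ancestors reached by such an in-edge form a directed path, which is mapped
    into one of the paths feeding the image of that vertex. *)

Set Implicit Arguments.
Unset Strict Implicit.
Unset Printing Implicit Defensive.

(** * Counting in concatenated families *)

Section CountingInFamilies.

Variables (A B : eqType) (F : A -> seq B).

Lemma count_flatten_map_le (P : pred B) (Q : pred A) c ws :
  (forall s, s \in ws -> count P (F s) <= c * Q s) ->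
  count P (flatten [seq F s | s <- ws]) <= c * count Q ws.
Proof.
elim: ws => [|s ws IH] //= leF; rewrite count_cat mulnDr.
by rewrite leq_add ?leF ?mem_head ?IH // => z zws; rewrite leF // inE zws orbT.
Qed.

Lemma size_flatten_map_ge c ws :
  (forall s, s \in ws -> c <= size (F s)) ->
  c * size ws <= size (flatten [seq F s | s <- ws]).
Proof.
elim: ws => [|s ws IH] /= leF; first by rewrite muln0.
rewrite size_cat mulnS leq_add ?leF ?mem_head ?IH // => z zws.
by rewrite leF // inE zws orbT.
Qed.

Lemma count_union_bound (P : pred A) (Q : B -> pred A) (js : seq B) ws :
  (forall s, s \in ws -> P s -> has (fun j => Q j s) js) ->
  count P ws <= \sum_(j <- js) count (Q j) ws.
Proof.
elim: ws => [|s ws IH] /= hasQ; first by rewrite big1.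
rewrite big_split /= leq_add ?IH // => [|z zws]; last first.
  by apply: hasQ; rewrite inE zws orbT.
case Ps: (P s) => //=; have := hasQ s (mem_head _ _) Ps.
elim: js {hasQ IH} => [|j js IHj] //=; rewrite big_cons.
by case/orP=> [->|/IHj]; lia.
Qed.

End CountingInFamilies.

(** * Directed paths ending at a vertex *)

Section Legs.

Variables (W : finType) (g : rel W).

(* [v :: p] lists a directed path ending at [v], read backwards. *)
Definition leg v p := path [rel a b | g b a] v p && uniq (v :: p).

(** The end [v] itself may lie in [H]; in the embedding, [H] is the image built so far, which
    contains [v]. *)
Definition well_fed s l v :=
  [forall H : {set W}, (#|H| <= s) ==>
    [exists p : l.-tuple W, leg v p && all (fun z => z \notin H) p]].

Lemma well_fedP s l v (H : {set W}) : well_fed s l v -> #|H| <= s ->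
  exists p, [/\ size p = l, leg v p & forall z, z \in p -> z \notin H].
Proof.
move/forallP/(_ H)/implyP => fed /fed /existsP[p /andP[legp /allP pH]].
by exists p; rewrite size_tuple.
Qed.

Lemma starvedP s l v : ~~ well_fed s l v ->
  exists2 H : {set W}, #|H| <= s &
    forall p, size p = l -> leg v p -> exists2 z, z \in p & z \in H.
Proof.
case/forallPn => H; rewrite negb_imply => /andP[sH /existsPn noleg].
exists H => // p /eqP sp legp; have := noleg (Tuple sp); rewrite legp /=.
by case/allPn => z zp; rewrite negbK => zH; exists z.
Qed.

End Legs.

(** * Counting walks without short repetitions *)

Section Walks.

Variables (W : finType) (out : W -> seq W) (x0 : W) (l d : nat).
Hypothesis out_uniq : forall x, uniq (out x).
Hypothesis out_size : forall x, size (out x) <= d.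

Definition extensions s :=
  [seq v :: s | v <- out (head x0 s) & v \notin take l s].

(* Walks from [x0] of length [M], read backwards, in which any [l + 1]
   consecutive vertices are distinct. *)
Fixpoint walks M :=
  if M is M'.+1 then flatten [seq extensions s | s <- walks M']
  else [:: [:: x0]].

Lemma walksS_inv M s : s \in walks M.+1 ->
  exists v s', [/\ s = v :: s', s' \in walks M, v \in out (head x0 s') &
                   v \notin take l s'].
Proof.
case/flatten_mapP => s' s'M /mapP[v]; rewrite mem_filter => /andP[vn vo] ->.
by exists v, s'.
Qed.

Lemma walksP M s : s \in walks M ->
  [/\ size s = M.+1, sorted [rel a b | a \in out b] s & uniq (take l.+1 s)].
Proof.
elim: M s => [|M IH] s; first by rewrite inE => /eqP ->.
case/walksS_inv => v [s' [-> /IH[size_s' so un] vo vn]].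
split; rewrite /= ?size_s' ?vn //.
  by case: s' size_s' so vo {un vn} => //= a s' _ -> ->.
rewrite -[take l s'](take_takel _ (leqnSn l)); exact: take_uniq.
Qed.

Lemma count_extensions P s :
  count P (extensions s) <= count (fun v => P (v :: s)) (out (head x0 s)).
Proof.
rewrite /extensions count_map count_filter; apply: sub_count => v /=.
by case/andP.
Qed.

Lemma count_walks_behead Q M :
  count (fun s => Q (behead s)) (walks M.+1) <= d * count Q (walks M).
Proof.
apply: count_flatten_map_le => s _; apply: leq_trans (count_extensions _ _) _.
rewrite /=; case: (Q s); last by rewrite (eq_count (a2 := pred0)) // count_pred0.
by rewrite muln1 (leq_trans (count_size _ _)).
Qed.

Lemma count_walks_head Q v M :
  count (fun s => (head x0 s == v) && Q (behead s)) (walks M.+1) <=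
  count Q (walks M).
Proof.
rewrite -[leqRHS]mul1n.
apply: count_flatten_map_le => s _; apply: leq_trans (count_extensions _ _) _.
rewrite /=; case: (Q s); last first.
  by rewrite (eq_count (a2 := pred0)) ?count_pred0 // => z /=; rewrite andbF.
rewrite (eq_count (a2 := pred1 v)); last by move=> z /=; rewrite andbT.
by rewrite count_uniq_mem //; case: (_ \in _).
Qed.

Definition ending M v := count (fun s => head x0 s == v) (walks M).

Lemma count_walks_nth y i M :
  count (fun s => nth x0 s i == y) (walks (M + i)) <= d ^ i * ending M y.
Proof.
elim: i => [|i IH].
  rewrite addn0 mul1n /ending (eq_count (a2 := fun s => head x0 s == y)) //.
rewrite addnS expnS -mulnA.
apply: leq_trans (leq_mul (leqnn d) IH).
rewrite (eq_count (a2 := fun s => nth x0 (behead s) i == y)) => [|s /=].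
  exact: (count_walks_behead (fun s => nth x0 s i == y)).
by rewrite nth_behead.
Qed.

(** Of the [i.+1] steps after [y] the last is forced to hit [v], so only [i] factors [d] arise. *)
Lemma count_walks_between v y i M :
  count (fun s => (head x0 s == v) && (nth x0 s i.+1 == y)) (walks (M + i.+1))
  <= d ^ i * ending M y.
Proof.
rewrite addnS; apply: leq_trans (count_walks_nth y i M).
rewrite (eq_count (a2 := fun s =>
  (head x0 s == v) && (nth x0 (behead s) i == y))) => [|s /=].
  exact: (count_walks_head (fun s => nth x0 s i == y)).
by rewrite nth_behead.
Qed.

Lemma size_walks_le M : size (walks M) <= d ^ M.
Proof.
elim: M => [|M IH] //; rewrite expnS.
apply: leq_trans (leq_mul (leqnn d) IH).
have := count_walks_behead predT M.
by rewrite (eq_count (a2 := predT)) // !count_predT.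
Qed.

(** At each step the window excludes at most [l] out-neighbours, leaving [c] choices. *)
Lemma size_walks_ge c M : (forall x, c + l <= size (out x)) ->
  c ^ M <= size (walks M).
Proof.
move=> c_out; elim: M => [|M IH] //; rewrite expnS.
apply: leq_trans (leq_mul (leqnn c) IH) _; apply: size_flatten_map_ge => s _.
rewrite size_map size_filter -(leq_add2r l).
apply: leq_trans (c_out (head x0 s)) _.
rewrite -(count_predC (fun v => v \notin take l s)) leq_add2l.
rewrite -size_filter; apply: leq_trans (_ : size (take l s) <= l); last first.
  by rewrite size_take_min geq_minl.
apply: uniq_leq_size; first by rewrite filter_uniq.
by move=> z; rewrite mem_filter /= negbK => /andP[].
Qed.

Lemma size_walks_ending M : size (walks M) <= \sum_v ending M v.
Proof.
rewrite -count_predT; apply: count_union_bound => s _ _.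
by apply/hasP; exists (head x0 s) => //=; rewrite mem_index_enum.
Qed.

(* If the walks into every [v] are funnelled through a small set [H v], then
   reading a walk backwards from its end, jumping each time to a vertex of the
   current [H v], every jump saves a factor of about [d]. *)
Lemma ending_le (H : W -> {set W}) h rho M v :
  (forall M s, l <= M -> s \in walks M ->
     exists2 i, i < l & nth x0 s i.+1 \in H (head x0 s)) ->
  (forall v, #|H v| <= h) -> d = 3 * rho -> 0 < rho -> h * 3 ^ l <= rho ->
  ending M v <= d ^ l * rho ^ M.
Proof.
move=> funnel card_H d_rho rho_gt0 h_rho.
elim/ltn_ind: M v => M IH v; have [ltMl | leM] := ltnP M l.
  apply: leq_trans (count_size _ _) _; apply: leq_trans (size_walks_le M) _.
  rewrite -[leqLHS]muln1 leq_mul ?expn_gt0 ?rho_gt0 //.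
  by rewrite leq_pexp2l ?(ltnW ltMl) // d_rho muln_gt0.
pose js := [seq (i, y) | i <- iota 0 l, y <- enum (H v)].
apply: leq_trans
  (@count_union_bound _ _ _
     (fun j s => (head x0 s == v) && (nth x0 s j.1.+1 == j.2)) js _ _) _.
  move=> s sM /eqP s_v; have [i lt_il iH] := funnel M s leM sM.
  apply/hasP; exists (i, nth x0 s i.+1); last by rewrite /= s_v !eqxx.
  by rewrite allpairs_f ?mem_iota ?mem_enum // -s_v.
rewrite big_allpairs.
(* By induction a target at position [i] contributes [d ^ i * (d ^ l * rho ^ (M - i.+1))], which is
   [3 ^ i * (d ^ l * rho ^ M.-1)] because [d = 3 * rho]. *)
apply: leq_trans (_ : \sum_(i <- iota 0 l)
    h * (3 ^ i * (d ^ l * rho ^ M.-1)) <= _).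
  rewrite big_seq [leqRHS]big_seq; apply: leq_sum => i; rewrite mem_iota /=.
  rewrite add0n => lt_il; have lt_iM := leq_trans lt_il leM.
  rewrite big_enum /=.
  apply: leq_trans (_ : \sum_(y in H v) 3 ^ i * (d ^ l * rho ^ M.-1) <= _).
    apply: leq_sum => y _.
    have := count_walks_between v y i (M - i.+1); rewrite subnK // => le_c.
    apply: leq_trans le_c _.
    apply: leq_trans (leq_mul (leqnn _) (IH (M - i.+1) _ y)) _; first by clear -lt_iM; lia.
    rewrite {1}d_rho expnMn -mulnA leq_mul2l mulnCA; apply/orP; right.
    by rewrite leq_mul2l -expnD; apply/orP; right; rewrite leq_pexp2l //; clear -lt_iM; lia.
  by rewrite sum_nat_const leq_mul2r card_H orbT.
rewrite -big_distrr -big_distrl /=.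
have geom : \sum_(i <- iota 0 l) 3 ^ i <= 3 ^ l.
  have -> : iota 0 l = index_iota 0 l by rewrite /index_iota subn0.
  elim: (l) => [|n IHn]; first by rewrite big_geq.
  by rewrite big_nat_recr //= expnS; clear -IHn; lia.
have [M0|M_gt0] := posnP M.
  by move: leM; rewrite M0 leqn0 => /eqP ->; rewrite big_nil muln0.
rewrite -{2}(prednK M_gt0) expnS mulnA [leqRHS]mulnCA leq_mul2r.
by apply/orP; right; apply: leq_trans h_rho; rewrite leq_mul2l geom orbT.
Qed.

End Walks.

(** Were all of [X] starved, there would be at least [(2 * rho) ^ M] walks of length [M], but at
    most [#|W| * d ^ l * rho ^ M]: absurd for large [M]. *)
Lemma well_fed_exists (W : finType) (g : rel W) s l (X : {set W}) :
  X != set0 ->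
  (forall x, x \in X -> 3 * (s * 3 ^ l + l).+1 <= #|[set y in X | g x y]|) ->
  exists2 v, v \in X & well_fed g s l v.
Proof.
case/set0Pn => x0 x0X outdeg.
have [/exists_inP // | /exists_inPn starved] :=
  boolP [exists v in X, well_fed g s l v].
exfalso; set rho := (s * 3 ^ l + l).+1 in outdeg; pose d := 3 * rho.
(* Truncation leaves exactly [d] successors; a vertex outside [X] borrows those of [x0], so the
   degree bounds hold on all of [W]. *)
pose out x := take d (enum [set y in X | g (if x \in X then x else x0) y]).
have out_size x : size (out x) = d.
  rewrite size_takel // -cardE; apply: outdeg; by case: ifP.
have out_uniq x : uniq (out x) by rewrite take_uniq ?enum_uniq.
have out_X x z : z \in out x -> z \in X.
  by move/mem_take; rewrite mem_enum inE => /andP[].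
have out_g x z : x \in X -> z \in out x -> g x z.
  by move=> xX /mem_take; rewrite mem_enum inE xX => /andP[].
pose bottleneck v (H : {set W}) := (#|H| <= s) &&
  [forall p : l.-tuple W, leg g v p ==> [exists z in H, z \in (p : seq W)]].
pose H v := odflt set0 [pick H | bottleneck v H].
have card_H v : #|H v| <= s.
  by rewrite /H; case: pickP => [H' /andP[]|] //= _; rewrite cards0.
have HP v p : v \in X -> size p = l -> leg g v p ->
    exists2 z, z \in p & z \in H v.
  move=> vX /eqP sp legp; rewrite /H; case: pickP => [H' /andP[_]|noH] /=.
    by move/forallP/(_ (Tuple sp))/implyP/(_ legp)/exists_inP => -[z]; exists z.
  have [H' cH' hitH'] := starvedP (starved v vX).
  have /negP[] := noH H'; rewrite /bottleneck cH' /=.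
  apply/forallP => q; apply/implyP => /hitH'; rewrite size_tuple => -[] // z zq zH.
  by apply/exists_inP; exists z.
have walks_X M w : w \in walks out x0 l M -> {subset w <= X}.
  elim: M w => [|M IH] w; first by rewrite inE => /eqP -> z; rewrite inE => /eqP ->.
  case/walksS_inv => v [w' [-> /IH w'X vo _]] z; rewrite inE => /orP[/eqP ->|/w'X //].
  exact: out_X vo.
have funnel M w : l <= M -> w \in walks out x0 l M ->
    exists2 i, i < l & nth x0 w i.+1 \in H (head x0 w).
  move=> leM wM; have [] := walksP wM; have := walks_X M w wM.
  case: w {wM} => // v w wX [size_w] so un; rewrite /=.
  have size_p : size (take l w) = l by rewrite size_takel // size_w.
  (* The [l] vertices before the end of a walk form a leg, which must meet [H v]. *)
  have [||z zp zH] := HP v (take l w) _ size_p; first by rewrite wX ?mem_head.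
    rewrite /leg; move: un => /= ->; rewrite andbT take_path //.
    apply: sub_in_path so; last exact: (introT allP wX).
    by move=> a b _ bX /=; apply: out_g.
  exists (index z (take l w)); first by rewrite -{2}size_p index_mem.
  by rewrite -(@nth_take l) ?nth_index // -{2}size_p index_mem.
have le_end M v : ending out x0 l M v <= d ^ l * rho ^ M.
  have out_le x : size (out x) <= d by rewrite out_size.
  by apply: (ending_le out_uniq out_le M v funnel card_H); rewrite // /rho -addnS leq_addr.
have grow M : 2 ^ M <= #|W| * d ^ l.
  rewrite -(leq_pmul2r (_ : 0 < rho ^ M)) ?expn_gt0 // -expnMn.
  apply: leq_trans (size_walks_ge x0 (l := l) out_uniq M _) _.
    by move=> x; rewrite out_size /d /rho; lia.
  apply: leq_trans (size_walks_ending out x0 l M) _.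
  apply: leq_trans (_ : \sum_(v : W) d ^ l * rho ^ M <= _).
    by apply: leq_sum => v _; apply: le_end.
  by rewrite sum_nat_const mulnA.
by have := grow (#|W| * d ^ l); rewrite leqNgt ltn_expl.
Qed.

(** * Levels above the well fed vertices *)

Section Levels.

Variables (W : finType) (g : rel W) (s l D : nat).

Fixpoint level k : pred W :=
  if k is k'.+1 then fun x => D <= #|[set y | g x y & level k' y]|
  else well_fed g s l.

(* If no vertex of [X] has level [k.+1], discarding the vertices of level [k]
   costs every vertex of [X] fewer than [D] out-neighbours. *)
Lemma level_exists k (X : {set W}) : X != set0 ->
  (forall x, x \in X ->
     3 * (s * 3 ^ l + l).+1 + k * D <= #|[set y in X | g x y]|) ->
  exists2 x, x \in X & level k x.
Proof.
elim: k X => [|k IH] X X_neq0 outdeg.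
  by apply: well_fed_exists => // x /outdeg; rewrite addn0.
have [/exists_inP // | /exists_inPn nolevel] :=
  boolP [exists x in X, level k.+1 x].
exfalso; pose Y := [set x in X | ~~ level k x].
have Y_deg x : x \in X ->
    3 * (s * 3 ^ l + l).+1 + k * D <= #|[set y in Y | g x y]|.
  move=> xX; have := nolevel x xX; rewrite /= -ltnNge => few.
  have := outdeg x xX.
  rewrite -(cardsID [set y | level k y]) => le_card.
  have le1 : #|[set y in X | g x y] :&: [set y | level k y]| < D.
    apply: leq_ltn_trans few; apply: subset_leq_card; apply/subsetP => y.
    by rewrite !inE => /andP[/andP[_ ->] ->].
  have -> : [set y in Y | g x y] = [set y in X | g x y] :\: [set y | level k y].
    by apply/setP => y; rewrite !inE andbC andbA [RHS]andbC [g x y && _]andbC andbAC.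
  by lia.
case/set0Pn: X_neq0 => x0 x0X.
have [||y] := IH Y.
- apply/set0Pn; have : 0 < #|[set y in Y | g x0 y]| by apply: leq_trans (Y_deg _ x0X).
  by case/card_gt0P => y; rewrite inE => /andP[yY _]; exists y.
- by move=> x; rewrite inE => /andP[xX _]; apply: Y_deg.
by rewrite inE => /andP[_ /negP].
Qed.

End Levels.

(** * Trees through edge counts *)

Lemma connect_exit (V : finType) (e : rel V) (X : {set V}) a b :
  connect e a b -> a \in X -> b \notin X ->
  exists x y, [/\ x \in X, y \notin X & e x y].
Proof.
case/connectP => p + ->; elim: p a => [|z p IH] a /= => [_ ->|] //.
case/andP=> eaz pathp aX; have [/IH|zX _] := boolP (z \in X); first exact.
by exists a, z.
Qed.

Section Trees.

Variables (V : finType) (t : rel V).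
Hypothesis tree : oriented_tree t.
Implicit Types X Y Z : {set V}.

Definition edges (X : {set V}) : {set V * V} :=
  [set p | [&& t p.1 p.2, p.1 \in X & p.2 \in X]].

Definition link (X : {set V}) x (p : V * V) :=
  t p.1 p.2 && ((p.1 == x) && (p.2 \in X) || (p.2 == x) && (p.1 \in X)).

Lemma linkN X x p : x \notin X -> link X x p -> p \notin edges X.
Proof.
move=> xX /andP[_ ] /orP[] /andP[/eqP px _]; rewrite inE px (negPf xX) ?andbF //.
Qed.

Lemma link_edges X x p : link X x p -> p \in edges (x |: X).
Proof.
by case/andP=> tp /orP[] /andP[/eqP px pX]; rewrite !inE tp px pX eqxx ?orbT.
Qed.

Lemma edgesS X Y : X \subset Y -> edges X \subset edges Y.
Proof.
move/subsetP=> XY; apply/subsetP => p; rewrite !inE => /and3P[-> p1 p2].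
by rewrite !XY.
Qed.

Lemma frontier X : X != set0 -> X != setT ->
  exists a b, [/\ a \in X, b \notin X & und_adj t a b].
Proof.
case: tree => _ _ _ conn _ /set0Pn[a aX]; rewrite -subTset => /subsetPn[b _ bX].
exact: connect_exit (conn a b) aX bX.
Qed.

Lemma und_adj_link X a b : a \in X -> und_adj t a b -> exists p, link X b p.
Proof.
by move=> aX /orP[tab|tba]; [exists (a, b) | exists (b, a)];
  rewrite /link /= ?tab ?tba eqxx aX ?orbT.
Qed.

Lemma edges_linked X x p : x \notin X -> link X x p ->
  #|edges X| < #|edges (x |: X)|.
Proof.
move=> xX lp; rewrite proper_card // properE edgesS ?subsetUr //=.
by apply/subsetPn; exists p; [apply: link_edges | apply: linkN xX lp].
Qed.

(** Growing [X] to [V] by linked vertices adds at least one edge per vertex, and [V] carries only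
    [#|V| - 1] edges. *)
Lemma card_edges X : X != set0 -> #|edges X| < #|X|.
Proof.
have [n] := ubnP #|~: X|; elim: n X => // n IH X; rewrite ltnS => leXn X0.
have [->|XT] := eqVneq X setT.
  case: tree => V_gt0 _ _ _; rewrite cardsT /edges => cE.
  rewrite (_ : [set p | _] = [set p | t p.1 p.2]) ?cE; first by lia.
  by apply/setP => p; rewrite !inE !andbT.
have [a [b [aX bX /(und_adj_link aX)[p lp]]]] := frontier X0 XT.
have := edges_linked bX lp; have := IH (b |: X).
rewrite cardsU1 bX -card_gt0 cardsU1 bX => /(_ _ isT).
have := cardsC X; have := cardsC (b |: X); rewrite cardsU1 bX.
by move=> ? ? IHb lt; have := IHb ltac:(lia); lia.
Qed.

(* For the vertex sets of a tree: [tight] means connected. *)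
Definition tight X := #|edges X|.+1 == #|X|.

Lemma tight_neq0 X : tight X -> X != set0.
Proof. by rewrite -card_gt0 => /eqP <-. Qed.

Lemma tight1 x : tight [set x].
Proof.
rewrite /tight cards1 (_ : edges _ = set0) ?cards0 //.
apply/setP => p; rewrite !inE; apply/negP => /and3P[tp /eqP p1 /eqP p2].
by case: tree tp => _ irr _ _ _; rewrite p1 p2 irr.
Qed.

Lemma tightU1 X x p : tight X -> x \notin X -> link X x p -> tight (x |: X).
Proof.
move=> /eqP tX xX lp; have := edges_linked xX lp.
have /card_edges : x |: X != set0 by apply/set0Pn; exists x; rewrite setU11.
by rewrite /tight cardsU1 xX; lia.
Qed.

(** Two links would give [x |: X] as many edges as vertices. Hence extending an embedding from [X]
    to [x] means checking a single edge. *)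
Lemma tight_link_uniq X x p q : tight X -> x \notin X ->
  link X x p -> link X x q -> p = q.
Proof.
move=> /eqP tX xX lp lq; apply/eqP/negPn/negP => p_neq_q.
have /card_edges : x |: X != set0 by apply/set0Pn; exists x; rewrite setU11.
rewrite cardsU1 xX.
have /subset_leq_card : p |: (q |: edges X) \subset edges (x |: X).
  rewrite !subUset !sub1set !link_edges //=; exact/edgesS/subsetUr.
have p_new : p \notin q |: edges X by rewrite in_setU1 negb_or p_neq_q (linkN xX lp).
rewrite !cardsU1 p_new (linkN xX lq) !add1n -tX => le_e /(leq_ltn_trans le_e).
by rewrite ltnn.
Qed.

Lemma indeg_le1_uniq v x y : v \notin Uset t -> t x v -> t y v -> x = y.
Proof.
rewrite inE -ltnNge ltnS => /card_le1_eqP eq_in txv tyv.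
by apply: eq_in; rewrite inE.
Qed.

(** * Extending partial embeddings *)

Section Embedding.

Variables (W : finType) (g : rel W).
Hypothesis outdeg : min_outdeg_ge g #|V|.

Definition partial_embedding (X : {set V}) (f : V -> W) :=
  {in X &, injective f} /\ {in X &, forall u v, t u v -> g (f u) (f v)}.

Definition update (f : V -> W) x y z := if z == x then y else f z.

Lemma update_out f x y (X : {set V}) z : x \notin X -> z \in X ->
  update f x y z = f z.
Proof. by rewrite /update; case: eqP => // -> /negPf ->. Qed.

Lemma partial_embedding_update X f x p y :
  tight X -> partial_embedding X f -> x \notin X -> link X x p ->
  y \notin f @: X -> g (update f x y p.1) (update f x y p.2) ->
  partial_embedding (x |: X) (update f x y).
Proof.
move=> tX [injf homf] xX lp yX gp.
have fx : update f x y x = y by rewrite /update eqxx.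
have fX z : z \in X -> update f x y z = f z by exact: update_out.
have nf z : z \in X -> f z <> y by move=> zX fzy; rewrite -fzy imset_f in yX.
split=> u v; rewrite !inE.
  case/predU1P => [->|uX] /predU1P[->|vX] //; rewrite ?fx ?fX //.
  - by move/esym/nf.
  - by move/nf.
  - exact: injf.
case/predU1P => [->|uX] /predU1P[->|vX] tuv.
- by case: tree tuv => _ ->.
- by rewrite (tight_link_uniq tX xX lp (_ : link X x (x, v))) // in gp;
    rewrite /link /= tuv eqxx vX.
- by rewrite (tight_link_uniq tX xX lp (_ : link X x (u, x))) // in gp;
    rewrite /link /= tuv eqxx uX orbT.
by rewrite !fX // homf.
Qed.

Lemma card_imset_lt (X : {set V}) (f : V -> W) x : x \notin X -> #|f @: X| < #|V|.
Proof.
move=> xX; apply: leq_ltn_trans (leq_imset_card _ _) _.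
by rewrite -cardsT proper_card // properT; apply: contraNneq xX => ->.
Qed.

Lemma fresh_target (X : {set V}) (f : V -> W) (Y : {set W}) x :
  x \notin X -> #|V| <= #|Y| -> exists2 y, y \in Y & y \notin f @: X.
Proof.
move=> xX leY; apply/subsetPn; apply: contraL (card_imset_lt f xX) => /subset_leq_card.
by rewrite -leqNgt; apply: leq_trans.
Qed.

Definition fed_at_U (X : {set V}) (f : V -> W) :=
  [/\ tight X, partial_embedding X f, Uset t \subset X &
      forall u, u \in Uset t -> well_fed g #|V| #|V| (f u)].

Lemma fed_at_U_update X f x p y :
  fed_at_U X f -> x \notin X -> link X x p ->
  y \notin f @: X -> g (update f x y p.1) (update f x y p.2) ->
  fed_at_U (x |: X) (update f x y).
Proof.
move=> [tX eX UX fed] xX lp yX gp; split.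
- exact: tightU1 lp.
- exact: partial_embedding_update lp _ _.
- exact: subset_trans UX (subsetUr _ _).
by move=> u uU; rewrite (update_out _ _ xX) ?fed ?(subsetP UX).
Qed.

(** [Z] holds the vertices that may still lack in-neighbours: [Uset t], and possibly the vertex [w]
    whose ancestors are being placed. *)
Definition in_closed_but (X Z : {set V}) :=
  forall a x, a \in X -> a \notin Z -> t x a -> x \in X.

(** The leg is at least as long as the number of vertices still to place, so it cannot run out. *)
Definition spare_leg (X : {set V}) f w p :=
  [/\ leg g (f w) p, #|~: X| <= size p & forall z, z \in p -> z \notin f @: X].

Lemma card_setCU1 (X : {set V}) x n :
  x \notin X -> #|~: X| <= n.+1 -> #|~: (x |: X)| <= n.
Proof.
move=> xX; have := cardsC X; have := cardsC (x |: X); rewrite cardsU1 xX.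
by rewrite add1n; lia.
Qed.

(** [x] is sent to the first vertex of [p] and the tail becomes its own leg. Then [w] needs no
    exemption: if outside [Uset t], its only in-neighbour is [x]. *)
Lemma spare_leg_step X f w p x :
  fed_at_U X f -> w \in X -> in_closed_but X (w |: Uset t) ->
  spare_leg X f w p -> x \notin X -> t x w ->
  exists f' p', [/\ fed_at_U (x |: X) f',
    in_closed_but (x |: X) (x |: Uset t) & spare_leg (x |: X) f' x p'].
Proof.
move=> fedX wX clX [legp sizep pX] xX txw.
have : 0 < size p by apply: leq_trans sizep; apply/card_gt0P; exists x; rewrite inE.
case: p legp sizep pX => // y p; rewrite /leg /= -andbA.
move=> /and4P[gyw pathp _ /andP[yp up]] sizep pX _.
exists (update f x y), p; split.
- apply: (fed_at_U_update (p := (x, w)) fedX xX) => /=.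
  + by rewrite /link /= txw eqxx wX.
  + by apply: pX; rewrite mem_head.
  by rewrite (update_out f y xX wX) /update eqxx.
- move=> a z; rewrite !inE negb_or => /predU1P[-> /andP[/eqP] //|aX] /andP[_ aU] tza.
  have [aw|/eqP aw] := eqVneq a w; last first.
    by rewrite (clX a z) ?orbT // !inE negb_or aU andbT; apply/eqP.
  by rewrite aw in tza aU; rewrite (indeg_le1_uniq _ tza txw) ?eqxx // inE.
split; first by rewrite /leg /update eqxx /= pathp yp up.
  exact: card_setCU1.
move=> z zp; apply/imsetP => -[u]; rewrite !inE => /predU1P[->|uX].
  by rewrite /update eqxx => zy; rewrite -zy zp in yp.
rewrite (update_out f y xX uX) => zfu.
have zX : z \notin f @: X by apply: pX; rewrite inE zp orbT.
by rewrite zfu imset_f in zX.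
Qed.

(** One induction on two states: no chain of ancestors in progress, or one in progress at [w]. In
    the first state an out-edge is mapped greedily and an in-edge starts a chain; a chain that ends
    restores the first state. *)
Lemma embedding_complete n X f :
  #|~: X| <= n -> fed_at_U X f ->
  (in_closed_but X (Uset t) -> contains_subgraph t g) /\
  (forall w p, w \in X -> in_closed_but X (w |: Uset t) ->
     spare_leg X f w p -> contains_subgraph t g).
Proof.
elim: n X f => [|n IH] X f sizeX fedX.
  have X_T : X = setT.
    by rewrite -[X]setCK (_ : ~: X = set0) ?setC0 //; apply/eqP; rewrite -cards_eq0 -leqn0.
  have cont : contains_subgraph t g.
    case: fedX => _ [injf homf] _ _; rewrite X_T in injf homf.
    by exists f; split=> [u v|u v]; [apply: injf|apply: homf].
  by split.
have via_leg w p x : w \in X -> in_closed_but X (w |: Uset t) ->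
    spare_leg X f w p -> x \notin X -> t x w -> contains_subgraph t g.
  move=> wX clX lp xX txw.
  have [f' [p' [fed' cl' lp']]] := spare_leg_step fedX wX clX lp xX txw.
  have [_] := IH _ _ (card_setCU1 xX sizeX) fed'; apply; last exact: lp'.
    by rewrite setU11.
  exact: cl'.
have closed_case : in_closed_but X (Uset t) -> contains_subgraph t g.
  move=> clX; have [tX [injf homf] UX fed] := fedX.
  have [X_T|X_neqT] := eqVneq X setT.
    rewrite X_T in injf homf.
    by exists f; split=> [u v|u v]; [apply: injf|apply: homf].
  have [a [b [aX bX /orP[tab|tba]]]] := frontier (tight_neq0 tX) X_neqT.
    have [y] := fresh_target f bX (outdeg (f a)); rewrite inE => gay yX.
    have lab : link X b (a, b) by rewrite /link /= tab eqxx aX orbT.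
    have fed' : fed_at_U (b |: X) (update f b y).
      apply: (fed_at_U_update fedX bX lab yX) => /=.
      by rewrite (update_out f y bX aX) /update eqxx.
    have [+ _] := IH _ _ (card_setCU1 bX sizeX) fed'; apply=> c z.
    rewrite !inE => /predU1P[->|cX] cU tzc; last by rewrite (clX c z) ?orbT ?inE.
    by rewrite (indeg_le1_uniq _ tzc tab) ?aX ?orbT // inE.
  (* Closedness forces an edge entering [X] to end in [Uset t], where a leg avoiding [f @: X] is
     available. *)
  have aU : a \in Uset t.
    by apply: contraR bX => aU; apply: clX aX aU tba.
  have [p [sizep legp pX]] :=
    well_fedP (fed a aU) (ltnW (card_imset_lt f bX)).
  apply: (via_leg a p b) => //.
    by move=> c z cX; rewrite !inE negb_or => /andP[_ cU]; apply: clX; rewrite ?inE.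
  by split=> //; rewrite sizep max_card.
split=> // w p wX clX lp.
have [/existsP[x /andP[xX txw]]|noin] := boolP [exists x, (x \notin X) && t x w].
  exact: via_leg lp xX txw.
apply: closed_case => a x aX aU txa.
have [aw|a_neq_w] := eqVneq a w; last first.
  by apply: clX txa; rewrite // !inE negb_or a_neq_w; rewrite inE in aU.
apply: contraNT noin => xX; apply/existsP; exists x; by rewrite xX -aw.
Qed.

(** * Greedy embedding of an out-arborescence *)

Section Arborescence.

Variables (S : {set V}) (r : V) (h : V -> int) (c : int).
Hypothesis h_height : height_fun t h.
Hypothesis r_S : r \in S.
Hypothesis reach :
  forall v, v \in S -> connect [rel a b | t a b && (a \in S) && (b \in S)] r v.

(** [c] stands for the common height of [Uset t]: the level counts the steps left to that height,
    where it becomes well fed. *)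
Definition levelled (X : {set V}) (f : V -> W) :=
  forall v, v \in X -> (h v <= c)%R ->
    level g #|V| #|V| #|V| (absz (c - h v)%R) (f v).

Lemma arborescence_embedding x0 : level g #|V| #|V| #|V| (absz (c - h r)%R) x0 ->
  exists f, [/\ tight S, partial_embedding S f & levelled S f].
Proof.
move=> lev0; suff grow n X f : #|S :\: X| <= n -> X \subset S -> r \in X ->
    tight X -> partial_embedding X f -> levelled X f ->
    exists f, [/\ tight S, partial_embedding S f & levelled S f].
  apply: (grow #|S :\: [set r]| [set r] (fun=> x0)) => //.
  - by rewrite sub1set.
  - exact: set11.
  - exact: tight1.
  - split=> u v /set1P -> /set1P -> // trr.
    by case: tree trr => _ ->.
  by move=> v /set1P ->.
elim: n X f => [|n IH] X f leS XS rX tX eX lX.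
  have -> : S = X; last by exists f.
  by apply/eqP; rewrite eqEsubset XS andbT -setD_eq0 -cards_eq0 -leqn0.
have [SX|/subsetPn[v vS vX]] := boolP (S \subset X).
  have -> : S = X; last by exists f.
  by apply/eqP; rewrite eqEsubset XS SX.
have [a [b [aX bX /= /andP[/andP[tab aS] bS]]]] := connect_exit (reach vS) rX vX.
have h_b := h_height tab.
have [y gay [yX ly]] : exists2 y, g (f a) y & y \notin f @: X /\
    ((h b <= c)%R -> level g #|V| #|V| #|V| (absz (c - h b)%R) y).
  (* Up to height [c] the level of [f a] supplies [#|V|] candidates one level lower; beyond it the
     out-degree does. *)
  have [hb|hb] := boolP (h b <= c)%R.
    have [ha dist_ab] : (h a <= c)%R /\ absz (c - h a)%R = (absz (c - h b)%R).+1.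
      by clear -h_b hb; split; lia.
    have /= := lX a aX ha; rewrite dist_ab => /(fresh_target f bX)[y].
    by rewrite inE => /andP[gay ly] yX; exists y.
  have [y] := fresh_target f bX (outdeg (f a)); rewrite inE => gay yX.
  by exists y.
have lab : link X b (a, b) by rewrite /link /= tab eqxx aX orbT.
apply: (IH (b |: X) (update f b y)).
- have := cardsD1 b (S :\: X); rewrite inE bX bS setDDl setUC.
  by move=> eS; move: leS; rewrite eS add1n ltnS.
- by rewrite subUset sub1set bS.
- by rewrite inE rX orbT.
- exact: tightU1 lab.
- apply: (partial_embedding_update tX eX bX lab yX) => /=.
  by rewrite (update_out f y bX aX) /update eqxx.
move=> u; rewrite !inE => /predU1P[->|uX]; first by rewrite /update eqxx.
by rewrite (update_out f y bX uX); apply: lX.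
Qed.

End Arborescence.

End Embedding.

(** * Enlarging the minimal subtree upwards *)

Definition rooted_hull r (S : {set V}) :=
  [/\ r \in S, Uset t \subset S &
      forall v, v \in S -> connect [rel a b | t a b && (a \in S) && (b \in S)] r v].

Lemma height_connect h (S : {set V}) u v : height_fun t h ->
  connect [rel a b | t a b && (a \in S) && (b \in S)] u v -> (h u <= h v)%R.
Proof.
move=> h_height /connectP[p + ->]; elim: p u => [|z p IH] u /=; first by lia.
by case/andP=> /andP[/andP[/h_height hz _] _] /IH; lia.
Qed.

(* Prepending in-neighbours to the root terminates at a root that is a source
   or lies in [Uset t]; heights ensure that the new vertices are new. *)
Lemma rooted_hull_top h r S : height_fun t h -> rooted_hull r S ->
  exists r' S', rooted_hull r' S' /\ (r' \in Uset t \/ forall x, ~~ t x r').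
Proof.
move=> h_height; have [n] := ubnP #|~: S|; elim: n r S => // n IH r S.
rewrite ltnS => leS [rS US reach].
have [rU|rU] := boolP (r \in Uset t); first by exists r, S; split=> //; left.
have [/existsP[x txr]|/existsPn src] := boolP [exists x, t x r]; last first.
  by exists r, S; split=> //; right.
have xS : x \notin S.
  apply/negP => /reach /(height_connect h_height).
  by have := h_height _ _ txr; lia.
apply: (IH x (x |: S)).
  have := cardsC S; have := cardsC (x |: S); rewrite cardsU1 xS; lia.
split; rewrite ?setU11 //; first exact: subset_trans US (subsetUr _ _).
move=> v /setU1P[->|vS]; first exact: connect0.
apply: (@connect_trans _ _ r).
  by apply: connect1; rewrite /= txr setU11 inE rS orbT.
apply: connect_sub (reach v vS) => a b /= /andP[/andP[tab aS] bS].
by apply: connect1; rewrite /= tab !inE aS bS !orbT.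
Qed.

(** If [a] is not [r], the path from [r] enters [a] from within [S], through its only in-edge; [top]
    settles [r]. *)
Lemma rooted_hull_in_closed r S : rooted_hull r S ->
  (r \in Uset t \/ forall x, ~~ t x r) -> in_closed_but S (Uset t).
Proof.
move=> [rS US reach] top a x aS aU txa.
have [ar|a_neq_r] := eqVneq a r.
  case: top => [rU|/(_ x)]; first by rewrite ar rU in aU.
  by rewrite -ar txa.
have [||b [z [_]]] := @connect_exit _ _ [set~ a] r a (reach a aS).
- by rewrite !inE eq_sym.
- by rewrite !inE negbK.
rewrite !inE negbK => /eqP -> /= /andP[/andP[tba bS] _].
by rewrite (indeg_le1_uniq aU txa tba).
Qed.

End Trees.

(** * Choice of the degree bound and assembly *)

Theorem theorem1p5 (V : finType) (t : rel V) :
  oriented_tree t -> grounded t ->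
  out_arborescence_on t (min_subtree t (Uset t)) ->
  exists d : nat, forall (W : finType) (g : rel W),
    0 < #|W| -> irreflexive g -> min_outdeg_ge g d ->
    contains_subgraph t g.
Proof.
move=> tree [h [h_height h_U]] arb.
have U_min : Uset t \subset min_subtree t (Uset t).
  apply/subsetP => u uU; rewrite inE; apply/forallP => X; apply/implyP.
  by case/andP=> /subsetP UX _; apply: UX.
have [r0 [S0 hull0]] : exists r S, rooted_hull t r S.
  case: arb U_min => [-> U0|[r rS reach] U_min].
    have [/card_gt0P[v _] _ _ _ _] := tree.
    exists v, [set v]; split; rewrite ?set11 ?(subset_trans U0) ?sub0set //.
    by move=> u /set1P ->; apply: connect0.
  by exists r, (min_subtree t (Uset t)).
have [r [S [hull top]]] := rooted_hull_top h_height hull0.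
have [rS US reach] := hull.
(* The common height given by groundedness, set to 0 if [Uset t] is empty. *)
pose c : int := if [pick u in Uset t] is Some u then h u else 0%R.
have h_c u : u \in Uset t -> h u = c.
  move=> uU; rewrite /c; case: pickP => [v vU|/(_ u)]; first exact: h_U.
  by rewrite uU.
pose n := #|V|; pose k := absz (c - h r)%R.
(* The first summand yields a well fed vertex for [s = l = n]; each of the [k] further levels costs
   [n]. *)
exists (3 * (n * 3 ^ n + n).+1 + k * n) => W g W_gt0 _ outdeg.
have outdeg_n : min_outdeg_ge g #|V|.
  by move=> x; apply: leq_trans (outdeg x); rewrite -/n; nia.
have [||x0 _ lev0] := @level_exists W g n n n k setT.
- by rewrite -card_gt0 cardsT.
- move=> x _; apply: leq_trans (outdeg x) _; apply: subset_leq_card.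
  by apply/subsetP => y; rewrite !inE.
have [f [tS eS lS]] :=
  arborescence_embedding tree outdeg_n h_height rS reach lev0.
have [|+ _] := embedding_complete tree outdeg_n (leqnn #|~: S|) (f := f).
  (* At height [c] the level is 0, which means well fed. *)
  split=> // u uU; have := lS u (subsetP US u uU).
  by rewrite (h_c u uU) GRing.subrr; apply.
apply; exact: rooted_hull_in_closed hull top.
Qed.
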